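(* Let $a,b\in\mathbb{R}$ with $a<b$, let $u=w+\boldsymbol{i}v$, where $w\in\mathbb{R}_+$, $v\in(0,\pi)$, and define $\alpha_u,\beta_u$ by $$\alpha_u:=\frac{\overline{u}\sinh(u)-u\sinh(\overline{u})}{2u\overline{u}(\cosh(u)-\cosh(\overline{u}))},\qquad\beta_u:=\frac{u\cosh(u)\sinh(\overline{u})-\overline{u}\cosh(\overline{u})\sinh(u)}{u\overline{u}(\cosh(u)-\cosh(\overline{u}))}.$$ Then, for all $f\in\mathscr{C}^4_{\mathbb{K}}([a,b])$, both of the following inequalities hold: $$\bigg|\alpha_uf(a)+\beta_uf\Big(\frac{a+b}{2}\Big)+\alpha_uf(b)-\frac{1}{b-a}\int_a^bf(x)\,dx\bigg|\leq\frac{(b-a)^3\big(v\sinh(w)-w\sin(v)\big)^2}{32(w^2+v^2)^2wv\sinh(w)\sin(v)}\cdot\bigg\|f''''+\frac{8(v^2-w^2)}{(b-a)^2}f''+\frac{16(w^2+v^2)^2}{(b-a)^4}f\bigg\|_1$$ and $$\bigg|\alpha_uf(a)+\beta_uf\Big(\frac{a+b}{2}\Big)+\alpha_uf(b)-\frac{1}{b-a}\int_a^bf(x)\,dx\bigg|\leq\frac{(b-a)^4(2\alpha_u+\beta_u-1)}{16(w^2+v^2)^2}\cdot\bigg\|f''''+\frac{8(v^2-w^2)}{(b-a)^2}f''+\frac{16(w^2+v^2)^2}{(b-a)^4}f\bigg\|_\infty.$$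
   Context: $\mathbb{K}$ is $\mathbb{R}$ or $\mathbb{C}$, and $\mathscr{C}^4_{\mathbb{K}}([a,b])$ is the space of four times continuously differentiable $\mathbb{K}$-valued functions on $[a,b]$. $\boldsymbol{i}$ is the imaginary unit, $\overline{u}$ is the complex conjugate of $u$, and $\mathbb{R}_+$ is the set of positive real numbers. The numbers $\alpha_u,\beta_u$ are real. The norms are $\|h\|_1=\int_a^b|h(t)|\,dt$ and $\|h\|_\infty$, the (essential) supremum of $|h|$ on $[a,b]$. *)

(* Defs.v *)
From Stdlib Require Import Reals Lra.
From Coquelicot Require Import Coquelicot.

Open Scope R_scope.

(* The scalar field K, as a Banach space over R. *)
Inductive scalar_field : Set := RealScalars | ComplexScalars.

Definition carrier (K : scalar_field) : CompleteNormedModule R_AbsRing :=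
  match K with
  | RealScalars => R_CompleteNormedModule
  | ComplexScalars => C_R_CompleteNormedModule
  end.

Coercion carrier : scalar_field >-> CompleteNormedModule.

Section OnInterval.

Context {V : CompleteNormedModule R_AbsRing}.
Variables a b : R.

Definition Icc (x : R) : Prop := a <= x <= b.

(* The derivative relative to [a, b], hence one-sided at the endpoints; the
   values of the function outside [a, b] play no role. *)
Definition is_derive_on (f : R -> V) (x : R) (l : V) : Prop :=
  filterdiff f (within Icc (locally x)) (fun h : R => scal h l).

Definition ex_derive_on (f : R -> V) (x : R) : Prop :=
  exists l : V, is_derive_on f x l.

Definition Derive_on (f : R -> V) (x : R) : V := iota (is_derive_on f x).

Fixpoint Derive_n_on (f : R -> V) (n : nat) : R -> V :=
  match n with
  | O => f
  | S m => Derive_on (Derive_n_on f m)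
  end.

Definition C_n_on (n : nat) (f : R -> V) : Prop :=
  (forall k x, (k < n)%nat -> Icc x -> ex_derive_on (Derive_n_on f k) x) /\
  (forall k, (k <= n)%nat -> continuous_on Icc (Derive_n_on f k)).

Definition norm_1 (h : R -> V) : R := RInt (fun t => norm (h t)) a b.

(* [real] discards nothing for a bounded [h] when [a <= b]; for a continuous
   [h] this is also the essential supremum of its norm. *)
Definition norm_inf (h : R -> V) : R :=
  real (Lub_Rbar (fun r => exists t, Icc t /\ r = norm (h t))).

End OnInterval.

Definition Cexp (z : C) : C := (exp (Re z) * cos (Im z), exp (Re z) * sin (Im z)).
Definition Csinh (z : C) : C := ((Cexp z - Cexp (- z)) / 2)%C.
Definition Ccosh (z : C) : C := ((Cexp z + Cexp (- z)) / 2)%C.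

Definition alphaC (u : C) : C :=
  ((Cconj u * Csinh u - u * Csinh (Cconj u))
   / (2 * u * Cconj u * (Ccosh u - Ccosh (Cconj u))))%C.

Definition betaC (u : C) : C :=
  ((u * Ccosh u * Csinh (Cconj u) - Cconj u * Ccosh (Cconj u) * Csinh u)
   / (u * Cconj u * (Ccosh u - Ccosh (Cconj u))))%C.

(* Both complex numbers above are real: see [RtoC_alpha] and [RtoC_beta]. *)
Definition alpha (u : C) : R := Re (alphaC u).
Definition beta (u : C) : R := Re (betaC u).

Lemma Cexp_conj z : Cexp (Cconj z) = Cconj (Cexp z).
Proof.
unfold Cexp, Cconj; destruct z as [x y]; simpl.
rewrite cos_neg, sin_neg; f_equal; ring.
Qed.

Lemma Cconj_half z : Cconj (z / 2) = (Cconj z / 2)%C.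
Proof.
destruct z as [x y]; unfold Cconj, Cdiv, Cmult, Cinv; simpl; f_equal; field.
Qed.

Lemma Csinh_conj z : Csinh (Cconj z) = Cconj (Csinh z).
Proof.
unfold Csinh; rewrite Cconj_half, Cminus_conj, <- !Cexp_conj, Copp_conj.
reflexivity.
Qed.

Lemma Ccosh_conj z : Ccosh (Cconj z) = Cconj (Ccosh z).
Proof.
unfold Ccosh; rewrite Cconj_half, Cplus_conj, <- !Cexp_conj, Copp_conj.
reflexivity.
Qed.

(* Numerator and denominator of both fractions are purely imaginary. *)
Lemma imaginary_quotient p q : Re p = 0 -> Re q = 0 -> Im (p / q)%C = 0.
Proof.
destruct p as [p1 p2], q as [q1 q2]; simpl; intros -> ->.
unfold Rdiv; ring.
Qed.

Lemma RtoC_Re z : Im z = 0 -> RtoC (Re z) = z.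
Proof. destruct z as [x y]; simpl; intros ->; reflexivity. Qed.

Lemma RtoC_alpha u : RtoC (alpha u) = alphaC u.
Proof.
apply RtoC_Re, imaginary_quotient; rewrite ?Csinh_conj, ?Ccosh_conj;
  destruct u as [x y]; destruct (Csinh (x, y)), (Ccosh (x, y)); simpl; ring.
Qed.

Lemma RtoC_beta u : RtoC (beta u) = betaC u.
Proof.
apply RtoC_Re, imaginary_quotient; rewrite ?Csinh_conj, ?Ccosh_conj;
  destruct u as [x y]; destruct (Csinh (x, y)), (Ccosh (x, y)); simpl; ring.
Qed.

(* Main.v *)
Require Import Defs.
From Stdlib Require Import Reals Lra Lia.
From Coquelicot Require Import Coquelicot.
Open Scope R_scope.

(* The error functional is integration against a Peano kernel: [E] equals the
   integral of [kernel * Lf], where on each half of [a, b] the kernel solves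
   [L kernel = - 1 / (b - a)], vanishes to order three at the endpoint, and has
   zero slope at the midpoint; its third derivatives at the endpoint and at the
   midpoint produce the weights alpha and beta (Green's identity, i.e. iterated
   integration by parts). The slope of the kernel is a positive multiple of
   [sinh (w t) sin (v t) (G t - G 1)] with [G t = v cot (v t) - w coth (w t)]
   decreasing, so the kernel is nonnegative with maximum at the midpoint, which
   gives the L^1 bound. Its integral is obtained by applying the identity to
   [f = 1], which gives the sup-norm bound. *)

(** * Retraction of the line onto [a, b] *)

Definition clamp (a b x : R) : R := Rmax a (Rmin b x).

Lemma clamp_Icc a b x : a <= b -> Icc a b (clamp a b x).
Proof.
intros hab; unfold clamp, Icc, Rmax, Rmin.
repeat destruct (Rle_dec _ _); lra.
Qed.

Lemma clamp_id a b x : Icc a b x -> clamp a b x = x.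
Proof.
unfold clamp, Icc, Rmax, Rmin; intros hx.
repeat destruct (Rle_dec _ _); lra.
Qed.

Lemma clamp_lipschitz a b x y :
  a <= b -> Rabs (clamp a b y - clamp a b x) <= Rabs (y - x).
Proof.
intros hab; unfold clamp, Rmax, Rmin, Rabs.
repeat destruct (Rle_dec _ _); repeat destruct (Rcase_abs _); lra.
Qed.

Lemma continuous_clamp a b x : a <= b -> continuous (clamp a b) x.
Proof.
intros hab P [eps hP]; exists eps; intros y hy; apply hP.
exact (Rle_lt_trans _ _ _ (clamp_lipschitz a b x y hab) hy).
Qed.

(** Turns continuity relative to [a, b] into ordinary continuity, the form in which integrability
    results apply. *)
Lemma continuous_comp_clamp {V : UniformSpace} a b (g : R -> V) x :
  a <= b -> continuous_on (Icc a b) g ->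
  continuous (fun y => g (clamp a b y)) x.
Proof.
intros hab hg.
apply (filterlim_comp _ _ _ (clamp a b) g (locally x)
         (within (Icc a b) (locally (clamp a b x))) (locally (g (clamp a b x)))).
- intros P hP.
  generalize (continuous_clamp a b x hab _ hP); unfold filtermap.
  apply filter_imp; intros y hy; exact (hy (clamp_Icc a b y hab)).
- exact (hg _ (clamp_Icc a b x hab)).
Qed.

(** * Identities in groups and normed modules *)

Lemma minus_plus_l {G : AbelianGroup} (x y : G) : minus (plus x y) x = y.
Proof.
transitivity (plus y (minus x x)).
- unfold minus; rewrite (plus_comm x); symmetry; apply plus_assoc.
- rewrite minus_eq_zero; apply plus_zero_r.
Qed.

Lemma minus_minus_cancel {G : AbelianGroup} (u p q : G) :
  minus (minus u q) (minus u p) = minus p q.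
Proof.
unfold minus at 1; rewrite opp_minus, plus_comm.
symmetry; apply minus_trans.
Qed.

(** The inequality converse to [norm_scal] comes from [norm_scal] itself, applied to the scalar
    [/ k] and the vector [scal k x]. *)
Lemma norm_scal_R {V : NormedModule R_AbsRing} (k : R) (x : V) :
  norm (scal k x) = Rabs k * norm x.
Proof.
apply Rle_antisym; [exact (norm_scal k x) |].
destruct (Req_dec k 0) as [-> | hk].
{ rewrite Rabs_R0, Rmult_0_l; apply norm_ge_0. }
assert (e : x = scal (/ k) (scal k x)).
{ rewrite scal_assoc; rewrite <- (scal_one x) at 1; f_equal.
  change (1 = / k * k); field; exact hk. }
assert (hs : norm x <= Rabs (/ k) * norm (scal k x))
  by (rewrite e at 1; exact (norm_scal (/ k) (scal k x))).
assert (hpos := Rabs_pos_lt k hk).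
rewrite Rabs_inv in hs; apply Rmult_le_compat_l with (r := Rabs k) in hs;
  [ | lra].
rewrite <- Rmult_assoc, Rinv_r, Rmult_1_l in hs by lra; exact hs.
Qed.

(** * Derivatives relative to a compact interval *)

Section Interval.

Context {V : CompleteNormedModule R_AbsRing}.

Lemma is_derive_on_bound a b (f : R -> V) x l (eps : posreal) :
  is_derive_on a b f x l ->
  locally x (fun y => Icc a b y ->
    norm (minus (minus (f y) (f x)) (scal (y - x) l)) <= eps * Rabs (y - x)).
Proof.
intros [_ hf]; apply (hf x); intros P hP.
apply filter_le_within; exact hP.
Qed.

(** As a < b, every neighbourhood of x contains another point y of [a, b]. There both linear
    approximations err by at most eps / 2 times |y - x|, so l1 and l2 differ by at most eps. *)
Lemma is_derive_on_unique a b (f : R -> V) x l1 l2 :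
  a < b -> Icc a b x ->
  is_derive_on a b f x l1 -> is_derive_on a b f x l2 -> l1 = l2.
Proof.
intros hab hx h1 h2.
cut (minus l1 l2 = zero).
{ intros e; apply (plus_reg_r (opp l2)); rewrite plus_opp_r; exact e. }
refine (norm_eq_zero (V := V) (minus l1 l2) _).
apply Rle_antisym; [ | apply norm_ge_0].
apply le_epsilon; intros eps heps; rewrite Rplus_0_l.
set (e2 := mkposreal _ (is_pos_div_2 (mkposreal eps heps))).
destruct (filter_and _ _ (is_derive_on_bound a b f x l1 e2 h1)
  (is_derive_on_bound a b f x l2 e2 h2)) as [d hd].
(* Move to the right of x, or to the left when x = b, without leaving the interval. *)
assert (hy : exists y, Icc a b y /\ y <> x /\ Rabs (y - x) < d).
{ assert (hd0 := cond_pos d); unfold Icc in *.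
  destruct (Rlt_dec x b) as [hxb | hxb].
  - exists (x + Rmin (d / 2) (b - x)).
    unfold Rmin; destruct (Rle_dec _ _); rewrite Rabs_pos_eq; lra.
  - exists (x - Rmin (d / 2) (x - a)).
    unfold Rmin; destruct (Rle_dec _ _); rewrite Rabs_left; lra. }
destruct hy as [y [hyI [hyx hyd]]].
destruct (hd y hyd) as [b1 b2]; specialize (b1 hyI); specialize (b2 hyI).
assert (hpos : 0 < Rabs (y - x)) by (apply Rabs_pos_lt; lra).
apply Rmult_le_reg_l with (1 := hpos).
assert (hn : Rabs (y - x) * norm (minus l1 l2)
  = norm (scal (y - x) (minus l1 l2))).
{ symmetry; exact (norm_scal_R (V := V) (y - x) (minus l1 l2)). }
rewrite hn.
set (u := minus (f y) (f x)) in b1, b2.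
set (p := scal (y - x) l1) in b1; set (q := scal (y - x) l2) in b2.
replace (scal (y - x) (minus l1 l2)) with (minus (minus u q) (minus u p))
  by (rewrite minus_minus_cancel; symmetry;
      exact (scal_minus_distr_l (y - x) l1 l2)).
eapply Rle_trans; [exact (norm_triangle (minus u q) (opp (minus u p))) |].
replace (norm (opp (minus u p))) with (norm (minus u p))
  by (symmetry; exact (norm_opp (minus u p))).
simpl in b1, b2; lra.
Qed.

Lemma Derive_on_correct a b (f : R -> V) x :
  a < b -> Icc a b x -> ex_derive_on a b f x ->
  is_derive_on a b f x (Derive_on a b f x).
Proof.
intros hab hx [l hl]; unfold Derive_on; apply iota_correct.
exists l; split; [exact hl | intros l' hl'].
exact (is_derive_on_unique a b f x l l' hab hx hl hl').
Qed.

(* Two-sided differentiable on [a, b]: first-order Taylor extension beyond the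
   endpoints. *)
Definition extend a b (f f' : R -> V) (y : R) : V :=
  plus (f (clamp a b y)) (scal (y - clamp a b y) (f' (clamp a b y))).

Lemma extend_id a b (f f' : R -> V) x : Icc a b x -> extend a b f f' x = f x.
Proof.
intros hx; unfold extend; rewrite (clamp_id a b x hx).
transitivity (plus (f x) zero); [f_equal | apply plus_zero_r].
rewrite Rminus_diag; exact (scal_zero_l (f' x)).
Qed.

(** A point y near x either lies in [a, b], where the relative estimate applies, or clamps to x,
    where the extension is affine and the error is exactly zero. *)
Lemma is_derive_extend a b (f f' : R -> V) x :
  a < b -> Icc a b x -> is_derive_on a b f x (f' x) ->
  is_derive (extend a b f f') x (f' x).
Proof.
intros hab hx hf; split; [apply is_linear_scal_l |].
intros z hz.
apply (is_filter_lim_locally_unique (V := AbsRing_NormedModule R_AbsRing))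
  in hz.
subst z.
intros eps.
assert (hin := is_derive_on_bound a b f x (f' x) eps hf).
(* Near x, only an endpoint equal to x can be crossed; this excludes clamping to any other point. *)
assert (hl : locally x (fun y => x = a \/ a < y)).
{ destruct (Req_dec x a) as [e | n]; [apply filter_forall; auto |].
  assert (h : a < x) by (unfold Icc in hx; lra).
  generalize (open_gt a x h); apply filter_imp; auto. }
assert (hr : locally x (fun y => x = b \/ y < b)).
{ destruct (Req_dec x b) as [e | n]; [apply filter_forall; auto |].
  assert (h : x < b) by (unfold Icc in hx; lra).
  generalize (open_lt b x h); apply filter_imp; auto. }
generalize (filter_and _ _ hin (filter_and _ _ hl hr)); apply filter_imp.
intros y [h1 [h2 h3]].
change (norm (minus (minus (extend a b f f' y) (extend a b f f' x))
  (scal (y - x) (f' x))) <= eps * Rabs (y - x)).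
rewrite (extend_id a b f f' x hx).
assert (hcl : Icc a b y \/ clamp a b y = x).
{ unfold clamp, Icc, Rmax, Rmin in *.
  repeat destruct (Rle_dec _ _); lra. }
destruct hcl as [hy | hy].
- rewrite extend_id by assumption; exact (h1 hy).
- unfold extend; rewrite hy.
  apply Rle_trans with 0.
  + right; transitivity (norm (zero (G := V))); [ | exact norm_zero].
    f_equal; transitivity (minus (scal (y - x) (f' x)) (scal (y - x) (f' x)));
      [ | apply (minus_eq_zero (G := V))].
    f_equal; exact (minus_plus_l (G := V) (f x) (scal (y - x) (f' x))).
  + apply Rmult_le_pos; [apply Rlt_le, cond_pos | apply Rabs_pos].
Qed.

End Interval.

(** * Monotonicity and hyperbolic functions *)

Lemma nondecreasing_of_derive (g dg : R -> R) x y :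
  x <= y -> (forall z, x <= z <= y -> is_derive g z (dg z)) ->
  (forall z, x <= z <= y -> 0 <= dg z) -> g x <= g y.
Proof.
intros hxy hg hpos.
destruct (MVT_gen g x y dg) as [c [hc e]];
  rewrite ?Rmin_left, ?Rmax_right in * by assumption.
- intros z hz; apply hg; lra.
- intros z hz; apply continuity_pt_filterlim.
  apply (ex_derive_continuous g); exists (dg z); apply hg; lra.
- assert (h := Rmult_le_pos (dg c) (y - x) (hpos c hc)); lra.
Qed.

Lemma is_derive_sinh x : is_derive sinh x (cosh x).
Proof. apply is_derive_Reals, derivable_pt_lim_sinh. Qed.

Lemma is_derive_cosh x : is_derive cosh x (sinh x).
Proof. apply is_derive_Reals, derivable_pt_lim_cosh. Qed.

Lemma cosh_ge_1 x : 1 <= cosh x.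
Proof.
unfold cosh.
assert (h1 := exp_ineq1_le x); assert (h2 := exp_ineq1_le (- x)); lra.
Qed.

Lemma cosh2_sinh2 x : cosh x * cosh x = 1 + sinh x * sinh x.
Proof.
assert (h : exp x * exp (- x) = 1)
  by (rewrite <- exp_plus, Rplus_opp_r; apply exp_0).
unfold cosh, sinh; lra.
Qed.

Lemma sinh_ge x : 0 <= x -> x <= sinh x.
Proof.
intros hx.
assert (h : sinh 0 - 0 <= sinh x - x); [ | rewrite sinh_0 in h; lra].
apply (nondecreasing_of_derive (fun t => sinh t - t) (fun t => cosh t - 1));
  [assumption | |].
- intros z _; apply (is_derive_minus sinh (fun t => t));
    [apply is_derive_sinh | exact (is_derive_id (K := R_AbsRing) z)].
- intros z _; assert (h := cosh_ge_1 z); lra.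
Qed.

(** * Complex hyperbolic functions in real coordinates *)

Lemma Csinh_pair w v : Csinh (w, v) = (sinh w * cos v, cosh w * sin v).
Proof.
unfold Csinh, Cexp, sinh, cosh, Cdiv, Cminus, Cplus, Copp, Cmult, Cinv; simpl.
rewrite cos_neg, sin_neg; f_equal; field.
Qed.

Lemma Ccosh_pair w v : Ccosh (w, v) = (cosh w * cos v, sinh w * sin v).
Proof.
unfold Ccosh, Cexp, sinh, cosh, Cdiv, Cplus, Copp, Cmult, Cinv; simpl.
rewrite cos_neg, sin_neg; f_equal; field.
Qed.

Lemma sin2_cos2_mult x : sin x * sin x = 1 - cos x * cos x.
Proof. assert (h := sin2_cos2 x); unfold Rsqr in h; lra. Qed.

Lemma Re_imaginary_quotient x y : y <> 0 -> Re ((0, x) / (0, y))%C = x / y.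
Proof. intros hy; unfold Cdiv, Cmult, Cinv; simpl; field; exact hy. Qed.

(* Four-dimensional solution space of [(D^2 - u^2) (D^2 - conj u^2) y = 0],
   u = w + i v. *)
Definition htrig (w v p q r s t : R) : R :=
  p * (cosh (w * t) * cos (v * t)) + q * (sinh (w * t) * sin (v * t))
  + r * (sinh (w * t) * cos (v * t)) + s * (cosh (w * t) * sin (v * t)).

(** Differentiation acts linearly on the four coefficients, so derivatives of the kernel are checked
    by rational arithmetic on coefficients. *)
Lemma is_derive_htrig w v p q r s t :
  is_derive (htrig w v p q r s) t
    (htrig w v (w * r + v * s) (w * s - v * r) (w * p + v * q)
       (w * q - v * p) t).
Proof.
assert (hsh : is_derive (fun t => sinh (w * t)) t (w * cosh (w * t))).
{ apply (is_derive_comp sinh (fun t => w * t));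
    [apply is_derive_sinh | auto_derive; [exact I | ring]]. }
assert (hch : is_derive (fun t => cosh (w * t)) t (w * sinh (w * t))).
{ apply (is_derive_comp cosh (fun t => w * t));
    [apply is_derive_cosh | auto_derive; [exact I | ring]]. }
unfold htrig; auto_derive.
- repeat split; try (eexists; eassumption).
- replace (Derive (fun x => cosh (w * x)) t) with (w * sinh (w * t))
    by (symmetry; apply is_derive_unique, hch).
  replace (Derive (fun x => sinh (w * x)) t) with (w * cosh (w * t))
    by (symmetry; apply is_derive_unique, hsh).
  ring.
Qed.

(** * The Peano kernel on the unit interval *)

Section Kernel.

Variables w v : R.
Hypotheses (hw : 0 < w) (hv : 0 < v < PI).

Let rho := w ^ 2 + v ^ 2.

(** This is v cot (v t) - w coth (w t) multiplied by sinh (w t) sin (v t), which removes the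
    poles. *)
Definition cot_coth (t : R) : R :=
  v * sinh (w * t) * cos (v * t) - w * cosh (w * t) * sin (v * t).

Definition peano_coef : R := cot_coth 1 / (2 * w * v * sinh w * sin v).

(* [ker0] solves [y'''' + 2 (v^2 - w^2) y'' + rho^2 y = - 1] with
   [y 0 = y' 0 = y'' 0 = 0] and [y' 1 = 0] (the last condition determines
   [peano_coef]); [ker1], ..., [ker4] are its derivatives. *)
Definition ker0 (t : R) : R :=
  htrig w v (/ rho ^ 2) ((v ^ 2 - w ^ 2) / (2 * w * v) / rho ^ 2)
    (v * peano_coef / rho ^ 2) (- w * peano_coef / rho ^ 2) t - / rho ^ 2.
Definition ker1 (t : R) : R :=
  htrig w v 0 (- peano_coef / rho) (/ (2 * w * rho)) (- / (2 * v * rho)) t.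
Definition ker2 (t : R) : R :=
  htrig w v 0 (- / (2 * w * v)) (- v * peano_coef / rho)
    (- w * peano_coef / rho) t.
Definition ker3 (t : R) : R :=
  htrig w v (- 2 * w * v * peano_coef / rho)
    ((v ^ 2 - w ^ 2) * peano_coef / rho) (- / (2 * w)) (- / (2 * v)) t.
Definition ker4 (t : R) : R :=
  - 1 - 2 * (v ^ 2 - w ^ 2) * ker2 t - rho ^ 2 * ker0 t.

Lemma rho_pos : 0 < rho.
Proof. unfold rho; nra. Qed.

Lemma sin_pos : 0 < sin v.
Proof. apply sin_gt_0; lra. Qed.

Lemma sinh_pos : 0 < sinh w.
Proof. assert (h := sinh_ge w); lra. Qed.

Lemma rho_sinh_sin_pos : 0 < rho * (sinh w * sin v).
Proof.
exact (Rmult_lt_0_compat _ _ rho_pos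
  (Rmult_lt_0_compat _ _ sinh_pos sin_pos)).
Qed.

Lemma is_derive_ker0 t : is_derive ker0 t (ker1 t).
Proof.
assert (hr := rho_pos); unfold ker0, ker1.
evar_last.
- apply (is_derive_minus _ (fun _ => / rho ^ 2));
    [apply is_derive_htrig | apply is_derive_const].
- unfold minus, plus, opp, zero; simpl; rewrite Ropp_0, Rplus_0_r.
  unfold rho in *; f_equal; field; lra.
Qed.

Lemma is_derive_ker1 t : is_derive ker1 t (ker2 t).
Proof.
assert (hr := rho_pos); unfold ker1, ker2.
evar_last; [apply is_derive_htrig |].
unfold rho in *; f_equal; field; lra.
Qed.

Lemma is_derive_ker2 t : is_derive ker2 t (ker3 t).
Proof.
assert (hr := rho_pos); unfold ker2, ker3.
evar_last; [apply is_derive_htrig |].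
unfold rho in *; f_equal; field; lra.
Qed.

Lemma is_derive_ker3 t : is_derive ker3 t (ker4 t).
Proof.
assert (hr := rho_pos); unfold ker3, ker4, ker2, ker0.
evar_last; [apply is_derive_htrig |].
unfold htrig, rho in *; field; lra.
Qed.

Lemma htrig_0 p q r s : htrig w v p q r s 0 = p.
Proof.
unfold htrig; rewrite !Rmult_0_r, sinh_0, cosh_0, sin_0, cos_0; ring.
Qed.

Lemma ker0_0 : ker0 0 = 0.
Proof. unfold ker0; rewrite htrig_0; ring. Qed.

Lemma ker1_0 : ker1 0 = 0.
Proof. apply htrig_0. Qed.

Lemma ker2_0 : ker2 0 = 0.
Proof. apply htrig_0. Qed.

Lemma ker1_1 : ker1 1 = 0.
Proof.
assert (hr := rho_pos); assert (hsn := sin_pos); assert (hsh := sinh_pos).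
unfold ker1, htrig, peano_coef, cot_coth; rewrite !Rmult_1_r.
field; repeat split; lra.
Qed.

(** The maximum of the kernel; rescaling by ((b - a) / 2)^3 / 2 makes it the constant of the L^1
    bound. *)
Lemma ker0_1 : ker0 1 = (v * sinh w - w * sin v) ^ 2
  / (2 * rho ^ 2 * w * v * sinh w * sin v).
Proof.
assert (hr := rho_pos); assert (hsn := sin_pos); assert (hsh := sinh_pos).
unfold ker0, htrig, peano_coef, cot_coth; rewrite !Rmult_1_r.
assert (hc := cosh2_sinh2 w); assert (hs := sin2_cos2_mult v).
field_simplify_eq; [ | repeat split; lra].
ring_simplify.
(* With denominators cleared, the two sides agree modulo the hyperbolic and circular Pythagorean
   identities. *)
replace (cosh w ^ 2) with (1 + sinh w ^ 2)
  by (rewrite <- !Rsqr_pow2; unfold Rsqr; lra).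
replace (cos v ^ 2) with (1 - sin v ^ 2)
  by (rewrite <- !Rsqr_pow2; unfold Rsqr; lra).
ring.
Qed.

(** The factor 1 / 2 comes from rescaling: three derivatives of h^3 / 2 times the kernel in the
    variable x / h leave 1 / 2. *)
Lemma alpha_ker3 : alpha (w, v) = ker3 0 / 2.
Proof.
assert (hr := rho_pos); assert (hsn := sin_pos); assert (hsh := sinh_pos).
unfold alpha, alphaC, ker3; rewrite htrig_0, !Csinh_conj, !Ccosh_conj.
rewrite Csinh_pair, Ccosh_pair.
(* The numerator is a number minus its conjugate, and so is the last factor of the denominator; both
   are purely imaginary. *)
match goal with |- Re (?p / ?q)%C = _ =>
  replace p with ((0, - 2 * cot_coth 1) : C);
  [replace q with ((0, 4 * rho * (sinh w * sin v)) : C) |] end.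
- rewrite Re_imaginary_quotient by (assert (hp := rho_sinh_sin_pos); lra).
  unfold peano_coef, cot_coth; rewrite !Rmult_1_r.
  field; repeat split; lra.
- unfold rho; apply injective_projections; simpl; ring.
- unfold cot_coth; rewrite !Rmult_1_r.
  apply injective_projections; simpl; ring.
Qed.

(** The midpoint belongs to both halves of the interval, so two contributions of - [ker3 1] / 2 add
    up. *)
Lemma beta_ker3 : beta (w, v) = - ker3 1.
Proof.
assert (hr := rho_pos); assert (hsn := sin_pos); assert (hsh := sinh_pos).
assert (hc := cosh2_sinh2 w); assert (hs := sin2_cos2_mult v).
unfold beta, betaC, ker3; rewrite !Csinh_conj, !Ccosh_conj.
rewrite Csinh_pair, Ccosh_pair.
match goal with |- Re (?p / ?q)%C = _ =>
  replace p with
    ((0, 2 * (v * cosh w * sinh w - w * sin v * cos v)) : C);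
  [replace q with ((0, 2 * rho * (sinh w * sin v)) : C) |] end.
- rewrite Re_imaginary_quotient by (assert (hp := rho_sinh_sin_pos); lra).
  unfold htrig, peano_coef, cot_coth; rewrite !Rmult_1_r; unfold rho in *.
  field_simplify_eq; [ | repeat split; lra].
  ring_simplify.
  replace (cosh w ^ 2) with (1 + sinh w ^ 2)
    by (rewrite <- !Rsqr_pow2; unfold Rsqr; lra).
  replace (cos v ^ 2) with (1 - sin v ^ 2)
    by (rewrite <- !Rsqr_pow2; unfold Rsqr; lra).
  ring.
- unfold rho; apply injective_projections; simpl; ring.
- apply injective_projections; simpl; [ring |].
  transitivity (2 * (v * cosh w * sinh w * (sin v * sin v + cos v * cos v)
    - w * sin v * cos v * (cosh w * cosh w - sinh w * sinh w))).
  + rewrite hc, hs; ring.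
  + ring.
Qed.

Lemma is_derive_cot_coth t :
  is_derive cot_coth t (- rho * (sinh (w * t) * sin (v * t))).
Proof.
assert (e : forall x, htrig w v 0 0 v (- w) x = cot_coth x)
  by (intros x; unfold htrig, cot_coth; ring).
apply (is_derive_ext _ _ _ _ e).
evar_last; [apply is_derive_htrig |].
unfold htrig, rho; ring.
Qed.

Lemma sinh_sin_pos t : 0 < t <= 1 -> 0 < sinh (w * t) * sin (v * t).
Proof.
intros ht; apply Rmult_lt_0_compat.
- apply Rlt_le_trans with (w * t); [nra | apply sinh_ge; nra].
- apply sin_gt_0; nra.
Qed.

(* [v cot (v t) - w coth (w t)] decreases because
   [w sin (v t) <= w v t <= v sinh (w t)]. *)
Lemma cot_coth_decreasing t :
  0 < t <= 1 ->
  cot_coth 1 * (sinh (w * t) * sin (v * t)) <= cot_coth t * (sinh w * sin v).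
Proof.
intros ht.
set (D := fun t => sinh (w * t) * sin (v * t)).
assert (hD : forall z, is_derive D z
  (w * (cosh (w * z) * sin (v * z)) + v * (sinh (w * z) * cos (v * z)))).
{ assert (e : forall x, htrig w v 0 1 0 0 x = D x)
    by (intros x; unfold htrig, D; ring).
  intros z; apply (is_derive_ext _ _ _ _ e).
  evar_last; [apply is_derive_htrig |]; unfold htrig; ring. }
assert (hDt : 0 < D t) by exact (sinh_sin_pos t ht).
assert (hD1 : 0 < D 1) by (apply sinh_sin_pos; lra).
assert (h : - (cot_coth t / D t) <= - (cot_coth 1 / D 1)).
(* The derivative is v^2 / sin^2 (v z) - w^2 / sinh^2 (w z) over a common denominator. *)
{ apply (nondecreasing_of_derive (fun z => - (cot_coth z / D z)) (fun z =>
    ((v * sinh (w * z)) ^ 2 - (w * sin (v * z)) ^ 2) / (D z) ^ 2)); [lra | |].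
  - intros z hz.
    assert (hDz : 0 < D z) by (apply sinh_sin_pos; lra).
    assert (hc := cosh2_sinh2 (w * z)); assert (hs := sin2_cos2_mult (v * z)).
    evar_last.
    + apply @is_derive_opp, is_derive_div;
        [apply is_derive_cot_coth | apply hD | lra].
    + unfold opp; simpl.
      field_simplify_eq; [ | lra].
      unfold D, cot_coth, rho; ring_simplify.
      replace (cosh (w * z) ^ 2) with (1 + sinh (w * z) ^ 2)
        by (rewrite <- !Rsqr_pow2; unfold Rsqr; lra).
      replace (cos (v * z) ^ 2) with (1 - sin (v * z) ^ 2)
        by (rewrite <- !Rsqr_pow2; unfold Rsqr; lra).
      ring.
  - intros z hz.
    assert (hDz : 0 < D z) by (apply sinh_sin_pos; lra).
    apply Rmult_le_pos; [ | apply Rlt_le, Rinv_0_lt_compat, pow_lt, hDz].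
    assert (h1 : w * z <= sinh (w * z)) by (apply sinh_ge; nra).
    assert (h2 : sin (v * z) < v * z) by (apply sin_lt_x; nra).
    assert (h3 : 0 < sin (v * z)) by (apply sin_gt_0; nra).
    assert (h4 : w * sin (v * z) <= v * sinh (w * z)) by nra.
    assert (h5 : 0 <= w * sin (v * z)) by nra.
    nra. }
assert (h' : cot_coth 1 / D 1 <= cot_coth t / D t) by lra.
apply Rmult_le_compat_r with (r := D 1 * D t) in h'; [ | nra].
replace (cot_coth 1 / D 1 * (D 1 * D t)) with (cot_coth 1 * D t) in h'
  by (field; lra).
replace (cot_coth t / D t * (D 1 * D t)) with (cot_coth t * D 1) in h'
  by (field; lra).
unfold D in h'; rewrite !Rmult_1_r in h'; exact h'.
Qed.

(** Up to a positive factor, the slope is the gap between the two sides of [cot_coth_decreasing].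
    That inequality requires t > 0, so t = 0 is treated apart. *)
Lemma ker1_nonneg t : 0 <= t <= 1 -> 0 <= ker1 t.
Proof.
intros ht.
destruct (Req_dec t 0) as [-> | h0]; [rewrite ker1_0; lra |].
assert (hr := rho_pos); assert (hsn := sin_pos); assert (hsh := sinh_pos).
assert (hd := cot_coth_decreasing t); specialize (hd ltac:(lra)).
assert (hp : 0 < 2 * w * v * rho * (sinh w * sin v)).
{ rewrite (Rmult_assoc (2 * w * v)).
  assert (hwv := Rmult_lt_0_compat w v hw (proj1 hv)).
  apply Rmult_lt_0_compat; [lra | apply rho_sinh_sin_pos]. }
replace (ker1 t) with
  ((cot_coth t * (sinh w * sin v) - cot_coth 1 * (sinh (w * t) * sin (v * t)))
    / (2 * w * v * rho * (sinh w * sin v))).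
- apply Rmult_le_pos; [lra | apply Rlt_le, Rinv_0_lt_compat, hp].
- unfold ker1, htrig, peano_coef, cot_coth at 1.
  field; repeat split; lra.
Qed.

Lemma ker0_bounds t : 0 <= t <= 1 -> 0 <= ker0 t <= ker0 1.
Proof.
intros ht; rewrite <- ker0_0 at 1; split;
  (apply (nondecreasing_of_derive ker0 ker1); [lra | |];
   intros z hz; [apply is_derive_ker0 | apply ker1_nonneg; lra]).
Qed.

End Kernel.

(** * Green's identity for L = D^4 + p D^2 + q *)

Lemma is_derive_scal_fct {V : NormedModule R_AbsRing} (k : R -> R) (g : R -> V)
  x dk dg :
  is_derive k x dk -> is_derive g x dg ->
  is_derive (fun t => scal (k t) (g t)) x
    (plus (scal dk (g x)) (scal (k x) dg)).
Proof.
intros hk hg.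
apply (filterdiff_ext_lin _ (fun t : R =>
  plus (scal (scal t dk) (g x)) (scal (k x) (scal t dg)))).
- exact (filterdiff_scal_fct x k g _ _ Rmult_comm hk hg).
- intros t.
  rewrite scal_distr_l, !scal_assoc; f_equal; f_equal.
  apply Rmult_comm.
Qed.

(** The derivatives are supplied as a family, so that the explicit chain 1, 0, 0, ... qualifies
    without evaluating [Derive_n_on]. *)
Definition derive_chain {V : CompleteNormedModule R_AbsRing} (a b : R)
  (F : nat -> R -> V) : Prop :=
  (forall k x, (k < 4)%nat -> Icc a b x -> is_derive_on a b (F k) x (F (S k) x))
  /\ (forall k, (k <= 4)%nat -> continuous_on (Icc a b) (F k)).

Definition diff_op {V : CompleteNormedModule R_AbsRing} (p q : R)
  (F : nat -> R -> V) (x : R) : V :=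
  plus (plus (F 4%nat x) (scal p (F 2%nat x))) (scal q (F 0%nat x)).

Lemma derive_chain_Derive_n_on {V : CompleteNormedModule R_AbsRing} a b
  (f : R -> V) :
  a < b -> C_n_on a b 4 f -> derive_chain a b (Derive_n_on a b f).
Proof.
intros hab [hd hc]; split; [ | exact hc].
intros k x hk hx; apply Derive_on_correct; auto.
Qed.

Lemma derive_chain_one a b :
  derive_chain (V := R_CompleteNormedModule) a b
    (fun k _ => match k with O => 1 | _ => 0 end).
Proof.
split.
- intros k x _ _.
  apply (filterdiff_ext_lin _ (fun _ : R => zero)).
  + destruct k; apply filterdiff_const.
  + intros y; symmetry; apply Rmult_0_r.
- intros k _ x _; destruct k; apply filterlim_const.
Qed.

Lemma continuous_diff_op_clamp {V : CompleteNormedModule R_AbsRing} a b p q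
  (F : nat -> R -> V) x :
  a <= b -> derive_chain a b F ->
  continuous (fun y => diff_op p q F (clamp a b y)) x.
Proof.
intros hab [_ hF].
apply (continuous_plus (V := V)); [apply (continuous_plus (V := V)) |].
- apply (continuous_comp_clamp a b (F 4%nat)); auto with arith.
- apply (continuous_scal_r (V := V)), (continuous_comp_clamp a b (F 2%nat));
    auto with arith.
- apply (continuous_scal_r (V := V)), (continuous_comp_clamp a b (F 0%nat));
    auto with arith.
Qed.

(* There is no [ring] for modules: identities are checked
   coordinatewise in C. *)
Ltac scalar_ring :=
  match goal with K : scalar_field |- _ => destruct K end;
  [ | apply injective_projections];
  lazy -[R Rplus Rmult Ropp Rinv IZR fst snd]; cbn [fst snd]; ring.

(** The left side is the derivative of [concomitant] as the product rule delivers it. The mixed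
    terms cancel, and the equation for k4 says that L k0 = - m. *)
Lemma green_identity (K : scalar_field) (k0 k1 k2 k3 k4 p q m : R)
  (y0 y1 y2 y3 y4 : K) :
  k4 = - m - p * k2 - q * k0 ->
  minus
    (plus
      (minus (plus (scal k1 y3) (scal k0 y4)) (plus (scal k2 y2) (scal k1 y3)))
      (plus (scal (k3 + p * k1) y1) (scal (k2 + p * k0) y2)))
    (plus (scal (k4 + p * k2) y0) (scal (k3 + p * k1) y1))
  = plus (scal k0 (plus (plus y4 (scal p y2)) (scal q y0))) (scal m y0).
Proof. intros ->; scalar_ring. Qed.

(** The bilinear concomitant in Lagrange's identity for the formally self-adjoint operator L. *)
Definition concomitant {V : CompleteNormedModule R_AbsRing} (p : R)
  (k0 k1 k2 k3 : R -> R) (F : nat -> R -> V) (x : R) : V :=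
  minus
    (plus (minus (scal (k0 x) (F 3%nat x)) (scal (k1 x) (F 2%nat x)))
          (scal (k2 x + p * k0 x) (F 1%nat x)))
    (scal (k3 x + p * k1 x) (F 0%nat x)).

Lemma is_RInt_green (K : scalar_field) a b (F : nat -> R -> K)
  (k0 k1 k2 k3 : R -> R) p q m x0 x1 :
  a < b -> derive_chain a b F -> Icc a b x0 -> Icc a b x1 ->
  (forall x, is_derive k0 x (k1 x)) -> (forall x, is_derive k1 x (k2 x)) ->
  (forall x, is_derive k2 x (k3 x)) ->
  (forall x, is_derive k3 x (- m - p * k2 x - q * k0 x)) ->
  is_RInt (fun x => plus (scal (k0 x) (diff_op p q F x)) (scal m (F 0%nat x)))
    x0 x1
    (minus (concomitant p k0 k1 k2 k3 F x1) (concomitant p k0 k1 k2 k3 F x0)).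
Proof.
intros hab hF h0 h1 d0 d1 d2 d3.
assert (hin : forall x, Rmin x0 x1 <= x <= Rmax x0 x1 -> Icc a b x).
{ unfold Icc, Rmin, Rmax in *; intros x; destruct (Rle_dec _ _); lra. }
(* The fundamental theorem of calculus needs two-sided derivatives; the extensions have them and
   agree with F on [a, b]. *)
set (G := fun k => extend a b (F k) (F (S k))).
assert (hG : forall k x, (k < 4)%nat -> Icc a b x ->
  is_derive (G k) x (F (S k) x))
  by (intros; apply is_derive_extend; auto; apply hF; auto).
assert (eG : forall x, Icc a b x ->
  concomitant p k0 k1 k2 k3 G x = concomitant p k0 k1 k2 k3 F x)
  by (intros x hx; unfold concomitant, G; rewrite !extend_id by exact hx;
      reflexivity).
rewrite <- (eG x0 h0), <- (eG x1 h1).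
apply (is_RInt_ext (fun x => plus
  (scal (k0 x) (diff_op p q F (clamp a b x))) (scal m (F 0%nat (clamp a b x))))).
{ intros x hx; rewrite clamp_id by (apply hin; lra); reflexivity. }
apply is_RInt_derive.
- intros x hx; apply hin in hx; rewrite clamp_id by exact hx.
  evar_last.
  + apply (is_derive_minus (V := K)); [apply (is_derive_plus (V := K)) |].
    * apply (is_derive_minus (V := K)); apply (is_derive_scal_fct (V := K)).
      -- apply d0.
      -- apply (hG 3%nat); auto with arith.
      -- apply d1.
      -- apply (hG 2%nat); auto with arith.
    * apply (is_derive_scal_fct (V := K)).
      -- apply (is_derive_plus k2 (fun x => p * k0 x));
           [apply d2 | apply is_derive_scal, d0].
      -- apply (hG 1%nat); auto with arith.
    * apply (is_derive_scal_fct (V := K)).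
      -- apply (is_derive_plus k3 (fun x => p * k1 x));
           [apply d3 | apply is_derive_scal, d1].
      -- apply (hG 0%nat); auto with arith.
  + unfold G; rewrite !extend_id by exact hx.
    exact (green_identity K (k0 x) (k1 x) (k2 x) (k3 x) _ p q m _ _ _ _ _
      eq_refl).
- intros x hx.
  apply (continuous_plus (V := K)).
  + apply (continuous_scal (V := K)).
    * exact (ex_derive_continuous k0 x (ex_intro _ (k1 x) (d0 x))).
    * apply continuous_diff_op_clamp; [lra | exact hF].
  + apply (continuous_scal_r (V := K)), (continuous_comp_clamp a b (F 0%nat));
      [lra | apply hF; lia].
Qed.

(** * Integral representation of the error functional *)

Lemma is_derive_rescale (k dk : R -> R) C s e x :
  (forall t, is_derive k t (dk t)) ->
  is_derive (fun x => C * k (s * (x - e))) x (C * s * dk (s * (x - e))).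
Proof.
intros hk; rewrite Rmult_assoc; apply is_derive_scal.
apply (is_derive_comp k (fun x => s * (x - e))); [apply hk |].
auto_derive; [exact I | ring].
Qed.

(** Unprimed values belong to the midpoint, primed ones to the endpoint. The zeros are the slope of
    the kernel at the midpoint and its value, slope and second derivative at the endpoint. *)
Lemma half_sum (K : scalar_field) (A A' B B' al be C3 C3' s : R)
  (y0 y0' y1 y1' y2 y2' y3 y3' : K) :
  s = 1 \/ s = -1 -> C3 = - s * be / 2 -> C3' = s * al ->
  minus
    (minus (plus (minus (scal A y3) (scal 0 y2)) (scal B y1)) (scal C3 y0))
    (minus (plus (minus (scal 0 y3') (scal 0 y2')) (scal 0 y1')) (scal C3' y0'))
  = plus (plus (scal A y3) (scal B y1))
      (scal s (plus (scal (be / 2) y0) (scal al y0'))).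
Proof. intros [-> | ->] -> ->; scalar_ring. Qed.

(** Treats both halves at once: the integral runs from an endpoint e to the midpoint, with direction
    s and half-length h. The factor h^3 / 2 turns the right side - 1 of the kernel equation into - 1
    / (2 h). *)
Lemma is_RInt_peano_half (K : scalar_field) a b (F : nat -> R -> K) w v h s e :
  0 < w -> 0 < v < PI -> 0 < h -> s = 1 \/ s = -1 ->
  a < b -> derive_chain a b F -> Icc a b e -> Icc a b (e + s * h) ->
  is_RInt (fun x => plus
      (scal (h ^ 3 / 2 * ker0 w v (s / h * (x - e)))
        (diff_op (2 * (v ^ 2 - w ^ 2) / h ^ 2) ((w ^ 2 + v ^ 2) ^ 2 / h ^ 4) F x))
      (scal (/ (2 * h)) (F 0%nat x)))
    e (e + s * h)
    (plus
      (plus (scal (h ^ 3 / 2 * ker0 w v 1) (F 3%nat (e + s * h)))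
        (scal (h / 2 * ker2 w v 1 + (v ^ 2 - w ^ 2) * h * ker0 w v 1)
           (F 1%nat (e + s * h))))
      (scal s (plus (scal (beta (w, v) / 2) (F 0%nat (e + s * h)))
                    (scal (alpha (w, v)) (F 0%nat e))))).
Proof.
intros hw hv hh hs hab hF h0 h1.
set (p := 2 * (v ^ 2 - w ^ 2) / h ^ 2).
set (q := (w ^ 2 + v ^ 2) ^ 2 / h ^ 4).
assert (hs2 : s * s = 1) by (destruct hs as [-> | ->]; ring).
set (l0 := fun x => h ^ 3 / 2 * ker0 w v (s / h * (x - e))).
set (l1 := fun x => h ^ 3 / 2 * (s / h) * ker1 w v (s / h * (x - e))).
set (l2 := fun x => h ^ 3 / 2 * (s / h) * (s / h) * ker2 w v (s / h * (x - e))).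
set (l3 := fun x => h ^ 3 / 2 * (s / h) * (s / h) * (s / h)
                    * ker3 w v (s / h * (x - e))).
assert (d0 : forall x, is_derive l0 x (l1 x))
  by (intros x; apply is_derive_rescale, is_derive_ker0; assumption).
assert (d1 : forall x, is_derive l1 x (l2 x))
  by (intros x; apply is_derive_rescale, is_derive_ker1; assumption).
assert (d2 : forall x, is_derive l2 x (l3 x))
  by (intros x; apply is_derive_rescale, is_derive_ker2; assumption).
assert (d3 : forall x,
  is_derive l3 x (- / (2 * h) - p * l2 x - q * l0 x)).
{ intros x; evar_last.
  - apply is_derive_rescale, is_derive_ker3; assumption.
  - unfold ker4, l2, l0, p, q.
    destruct hs as [-> | ->]; field; lra. }
assert (harg1 : s / h * (e + s * h - e) = 1)
  by (transitivity (s * s); [field; lra | exact hs2]).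
assert (harg0 : s / h * (e - e) = 0) by ring.
evar_last.
- exact (is_RInt_green K a b F l0 l1 l2 l3 p q (/ (2 * h)) e (e + s * h)
    hab hF h0 h1 d0 d1 d2 d3).
- unfold concomitant, l0, l1, l2, l3.
  rewrite harg1, harg0, ker0_0, ker1_0, ker2_0, ker1_1 by assumption.
  rewrite !Rmult_0_r, !Rplus_0_r.
  replace (h ^ 3 / 2 * (s / h) * (s / h) * ker2 w v 1
           + p * (h ^ 3 / 2 * ker0 w v 1))
    with (h / 2 * ker2 w v 1 + (v ^ 2 - w ^ 2) * h * ker0 w v 1).
  2: { transitivity (h / 2 * (s * s) * ker2 w v 1
         + (v ^ 2 - w ^ 2) * h * ker0 w v 1); [rewrite hs2; ring |].
       unfold p; field; lra. }
  rewrite (half_sum K _ 0 _ 0 (alpha (w, v)) (beta (w, v)) _ _ s);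
    [ | exact hs | |].
  + reflexivity.
  + rewrite beta_ker3 by assumption.
    transitivity (s * s * s / 2 * ker3 w v 1); [field; lra |].
    rewrite hs2; field.
  + rewrite alpha_ker3 by assumption.
    transitivity (s * s * s / 2 * ker3 w v 0); [field; lra |].
    rewrite hs2; field.
Qed.

(** On [a, b] the argument of [ker0] is the distance to the nearer endpoint in units of the
    half-length, so the kernel is even about the midpoint. *)
Definition peano_kernel (a b w v x : R) : R :=
  ((b - a) / 2) ^ 3 / 2
  * ker0 w v (1 - Rabs (x - (a + b) / 2) / ((b - a) / 2)).

(** Here m collects the midpoint terms in f' and f'''. They do not depend on the direction and
    cancel, whereas the values of f carry the sign s and add. *)
Lemma peano_sum (K : scalar_field) (al be : R) (m x y z : K) :
  plus (plus m (scal 1 (plus (scal (be / 2) y) (scal al x))))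
    (opp (plus m (scal (-1) (plus (scal (be / 2) y) (scal al z)))))
  = plus (plus (scal al x) (scal be y)) (scal al z).
Proof.
replace be with (be / 2 + be / 2) at 3 by field.
generalize (be / 2); intros c; scalar_ring.
Qed.

Lemma is_RInt_peano (K : scalar_field) a b (F : nat -> R -> K) w v :
  0 < w -> 0 < v < PI -> a < b -> derive_chain a b F ->
  is_RInt (fun x => plus
      (scal (peano_kernel a b w v x)
        (diff_op (8 * (v ^ 2 - w ^ 2) / (b - a) ^ 2)
           (16 * (w ^ 2 + v ^ 2) ^ 2 / (b - a) ^ 4) F x))
      (scal (1 / (b - a)) (F 0%nat x)))
    a b
    (plus (plus (scal (alpha (w, v)) (F 0%nat a))
                (scal (beta (w, v)) (F 0%nat ((a + b) / 2))))
          (scal (alpha (w, v)) (F 0%nat b))).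
Proof.
intros hw hv hab hF.
set (h := (b - a) / 2); set (c := (a + b) / 2).
assert (hh : 0 < h) by (unfold h; lra).
replace (8 * (v ^ 2 - w ^ 2) / (b - a) ^ 2)
  with (2 * (v ^ 2 - w ^ 2) / h ^ 2) by (unfold h; field; lra).
replace (16 * (w ^ 2 + v ^ 2) ^ 2 / (b - a) ^ 4)
  with ((w ^ 2 + v ^ 2) ^ 2 / h ^ 4) by (unfold h; field; lra).
replace (1 / (b - a)) with (/ (2 * h)) by (unfold h; field; lra).
assert (hl : a + 1 * h = c) by (unfold h, c; field).
assert (hr : b + -1 * h = c) by (unfold h, c; field).
assert (hc : Icc a b c) by (unfold Icc, c; lra).
assert (il := is_RInt_peano_half K a b F w v h 1 a hw hv hh (or_introl eq_refl)
  hab hF ltac:(unfold Icc; lra) ltac:(rewrite hl; exact hc)).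
assert (ir := is_RInt_peano_half K a b F w v h (-1) b hw hv hh
  (or_intror eq_refl) hab hF ltac:(unfold Icc; lra)
  ltac:(rewrite hr; exact hc)).
rewrite hl in il; rewrite hr in ir.
(* The right half was integrated from b to the midpoint; reversing it supplies the minus sign of
   [peano_sum]. *)
apply is_RInt_swap in ir.
rewrite <- (peano_sum K _ _
  (plus (scal (h ^ 3 / 2 * ker0 w v 1) (F 3%nat c))
    (scal (h / 2 * ker2 w v 1 + (v ^ 2 - w ^ 2) * h * ker0 w v 1) (F 1%nat c)))).
apply (is_RInt_Chasles (V := K) _ a c b).
- eapply is_RInt_ext; [ | exact il].
  intros x hx; rewrite Rmin_left, Rmax_right in hx by (unfold c; lra).
  simpl; do 2 f_equal; unfold peano_kernel; fold h c.
  rewrite Rabs_left by lra; do 2 f_equal.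
  unfold h, c; field; lra.
- eapply is_RInt_ext; [ | exact ir].
  intros x hx; rewrite Rmin_left, Rmax_right in hx by (unfold c; lra).
  simpl; do 2 f_equal; unfold peano_kernel; fold h c.
  rewrite Rabs_pos_eq by lra; do 2 f_equal.
  unfold h, c; field; lra.
Qed.

(** * Size and integral of the kernel, and the sup norm *)

Lemma peano_kernel_bounds a b w v x :
  0 < w -> 0 < v < PI -> a < b -> Icc a b x ->
  0 <= peano_kernel a b w v x <= ((b - a) / 2) ^ 3 / 2 * ker0 w v 1.
Proof.
intros hw hv hab hx.
assert (hC : 0 < ((b - a) / 2) ^ 3 / 2)
  by (assert (h := pow_lt ((b - a) / 2) 3); lra).
assert (hk : 0 <= ker0 w v (1 - Rabs (x - (a + b) / 2) / ((b - a) / 2))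
  <= ker0 w v 1).
{ apply ker0_bounds; try assumption.
  assert (h1 : 0 <= Rabs (x - (a + b) / 2) <= (b - a) / 2).
  { split; [apply Rabs_pos |].
    unfold Icc in hx; apply Rabs_le; lra. }
  assert (h2 : 0 <= Rabs (x - (a + b) / 2) / ((b - a) / 2) <= 1); [ | lra].
  split.
  - apply Rmult_le_pos; [apply h1 | apply Rlt_le, Rinv_0_lt_compat; lra].
  - apply Rle_div_l; lra. }
unfold peano_kernel; split.
- apply Rmult_le_pos; [lra | apply hk].
- apply Rmult_le_compat_l; [lra | apply hk].
Qed.

Lemma is_RInt_peano_kernel a b w v :
  0 < w -> 0 < v < PI -> a < b ->
  is_RInt (peano_kernel a b w v) a b
    ((b - a) ^ 4 * (2 * alpha (w, v) + beta (w, v) - 1)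
      / (16 * (w ^ 2 + v ^ 2) ^ 2)).
Proof.
intros hw hv hab.
assert (hq : 0 < (w ^ 2 + v ^ 2)) by nra.
assert (h := is_RInt_peano RealScalars a b _ w v hw hv hab
  (derive_chain_one a b)).
assert (h1 := is_RInt_const (V := R_NormedModule) a b (1 / (b - a))).
(* For f = 1 the operator returns its zero-order coefficient; the scalar here is the reciprocal of
   that coefficient. *)
assert (h2 := is_RInt_scal _ _ _ ((b - a) ^ 4 / (16 * (w ^ 2 + v ^ 2) ^ 2)) _
  (is_RInt_minus _ _ _ _ _ _ h h1)).
evar_last.
- eapply is_RInt_ext; [ | exact h2].
  intros x _; unfold diff_op, minus, plus, opp, scal, mult; simpl.
  unfold mult; simpl; field; split; lra.
- unfold minus, plus, opp, scal, mult; simpl; unfold mult; simpl.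
  field; split; lra.
Qed.

Lemma norm_le_norm_inf {V : CompleteNormedModule R_AbsRing} a b (g : R -> V) x :
  a <= b -> (forall y, continuous (fun y => g (clamp a b y)) y) ->
  Icc a b x -> norm (g x) <= norm_inf a b g.
Proof.
intros hab hg hx; unfold norm_inf.
set (E := fun r => exists t, Icc a b t /\ r = norm (g t)).
assert (hE : E (norm (g x))) by (exists x; auto).
destruct (continuity_ab_maj (fun y => norm (g (clamp a b y))) a b hab)
  as [M [hM _]].
{ intros c _; apply continuity_pt_filterlim.
  apply (continuous_comp (fun y => g (clamp a b y)) norm); [apply hg |].
  apply (filterlim_norm (V := V)). }
destruct (Lub_Rbar_correct E) as [hub hlub].
assert (h1 := hub _ hE).
assert (h2 : Rbar_le (Lub_Rbar E) (norm (g (clamp a b M)))).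
{ apply hlub; intros r [t [ht ->]].
  specialize (hM t ht); rewrite (clamp_id a b t ht) in hM; exact hM. }
(* [real] would send an infinite bound to 0; [h2] rules out plus infinity and [h1] minus
   infinity. *)
destruct (Lub_Rbar E); simpl in *; tauto.
Qed.

Lemma plus_minus_r {G : AbelianGroup} (x y : G) : minus (plus x y) y = x.
Proof. rewrite plus_comm; apply minus_plus_l. Qed.

(** * The two error estimates *)

Theorem theorem5p1 (K : scalar_field) (a b w v : R)
  (hab : a < b) (hw : 0 < w) (hv : 0 < v < PI)
  (f : R -> K) (hf : C_n_on a b 4 f) :
  let u : C := (RtoC w + Ci * RtoC v)%C in
  let E : K :=
    minus
      (plus (plus (scal (alpha u) (f a)) (scal (beta u) (f ((a + b) / 2))))
            (scal (alpha u) (f b)))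
      (scal (1 / (b - a)) (RInt f a b)) in
  let Lf : R -> K := fun x =>
    plus
      (plus (Derive_n_on a b f 4 x)
            (scal (8 * (v ^ 2 - w ^ 2) / (b - a) ^ 2) (Derive_n_on a b f 2 x)))
      (scal (16 * (w ^ 2 + v ^ 2) ^ 2 / (b - a) ^ 4) (f x)) in
  norm E
    <= (b - a) ^ 3 * (v * sinh w - w * sin v) ^ 2
       / (32 * (w ^ 2 + v ^ 2) ^ 2 * w * v * sinh w * sin v)
       * norm_1 a b Lf
  /\
  norm E
    <= (b - a) ^ 4 * (2 * alpha u + beta u - 1)
       / (16 * (w ^ 2 + v ^ 2) ^ 2)
       * norm_inf a b Lf.
Proof.
intros u E Lf.
assert (hu : u = (w, v))
  by (unfold u; apply injective_projections; simpl; ring).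
assert (hle : a <= b) by lra.
assert (hF := derive_chain_Derive_n_on a b f hab hf).
assert (hcL : forall x, continuous (fun y => Lf (clamp a b y)) x)
  by (intros x; exact (continuous_diff_op_clamp a b _ _ _ x hle hF)).
assert (hcf : forall x, continuous (fun y => f (clamp a b y)) x)
  by (intros x; apply continuous_comp_clamp;
      [exact hle | exact (proj2 hF 0%nat (Nat.le_0_l 4))]).
assert (hif : is_RInt f a b (RInt f a b)).
{ apply (RInt_correct (V := K)).
  apply (ex_RInt_ext (fun y => f (clamp a b y))).
  - intros x hx; rewrite Rmin_left, Rmax_right in hx by exact hle.
    rewrite clamp_id; [reflexivity | unfold Icc; lra].
  - apply (ex_RInt_continuous (V := K)); auto. }
assert (hiL : is_RInt (fun x => norm (Lf x)) a b (norm_1 a b Lf)).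
{ apply (RInt_correct (V := R_CompleteNormedModule)).
  apply (ex_RInt_ext (fun y => norm (Lf (clamp a b y)))).
  - intros x hx; rewrite Rmin_left, Rmax_right in hx by exact hle.
    rewrite clamp_id; [reflexivity | unfold Icc; lra].
  - apply (ex_RInt_continuous (V := R_CompleteNormedModule)); intros x _.
    apply (continuous_comp (fun y => Lf (clamp a b y)) norm); [apply hcL |].
    apply (filterlim_norm (V := K)). }
(* Subtracting the mean of f from the Green representation leaves only the kernel term. *)
assert (hiE : is_RInt (fun x => scal (peano_kernel a b w v x) (Lf x)) a b E).
{ unfold E; rewrite hu.
  assert (h := is_RInt_minus _ _ _ _ _ _
    (is_RInt_peano K a b _ w v hw hv hab hF)
    (is_RInt_scal _ _ _ (1 / (b - a)) _ hif)).
  eapply is_RInt_ext; [ | exact h].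
  intros x _; exact (plus_minus_r (G := K) _ _). }
assert (hker : forall x, a <= x <= b ->
  norm (scal (peano_kernel a b w v x) (Lf x))
    = peano_kernel a b w v x * norm (Lf x)).
{ intros x hx.
  assert (hk := peano_kernel_bounds a b w v x hw hv hab hx).
  rewrite <- (Rabs_pos_eq (peano_kernel a b w v x)) at 2 by lra.
  exact (norm_scal_R (V := K) _ _). }
split.
(* L^1 bound: replace the kernel by its maximum and integrate [norm (Lf x)]. *)
- apply (norm_RInt_le _ _ a b _ _ hle) with (3 := is_RInt_scal _ _ _
    ((b - a) ^ 3 * (v * sinh w - w * sin v) ^ 2
      / (32 * (w ^ 2 + v ^ 2) ^ 2 * w * v * sinh w * sin v)) _ hiL) (2 := hiE).
  intros x hx; rewrite hker by exact hx.
  apply Rmult_le_compat_r; [apply norm_ge_0 |].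
  assert (hk := peano_kernel_bounds a b w v x hw hv hab hx).
  rewrite ker0_1 in hk by assumption.
  eapply Rle_trans; [apply hk | right].
  assert (hsn := sin_pos v hv); assert (hsh := sinh_pos w hw).
  field; repeat split; nra.
(* Sup-norm bound: replace [norm (Lf x)] by its supremum and integrate the nonnegative kernel. *)
- rewrite hu, Rmult_comm.
  apply (norm_RInt_le _ _ a b _ _ hle) with (3 := is_RInt_scal _ _ _
    (norm_inf a b Lf) _ (is_RInt_peano_kernel a b w v hw hv hab)) (2 := hiE).
  intros x hx; rewrite hker by exact hx.
  rewrite Rmult_comm; apply Rmult_le_compat_r.
  + apply (peano_kernel_bounds a b w v x hw hv hab hx).
  + exact (norm_le_norm_inf a b Lf x hle hcL hx).
Qed.
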